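(* Suppose that each group homomorphism $\phi_j\colon\mathbb{Z}^d\to\mathbb{Z}^{d_j}$, $j\in\{1,\ldots,m\}$, chooses a subset $S_j\subseteq\{1,\ldots,d\}$ of the loop indices. For $i\in\{1,\ldots,d\}$ let $H_i=\langle e_i\rangle\le\mathbb{Z}^d$ be the subgroup generated by the $i$th standard basis vector, i.e. nonzero only in the $i$th coordinate. Then, for any $s_1,\ldots,s_m\in[0,1]$, $$\operatorname{rank}(H_i)\le\sum_{j=1}^m s_j\operatorname{rank}(\phi_j(H_i))\qquad\text{for all } i\in\{1,2,\ldots,d\}$$ if and only if $$\operatorname{rank}(H)\le\sum_{j=1}^m s_j\operatorname{rank}(\phi_j(H))\qquad\text{for all subgroups } H\le\mathbb{Z}^d.$$
   Context: That $\phi_j$ chooses the subset $S_j$ of the loop indices means that $\phi_j(i_1,\ldots,i_d)$ is the tuple of the coordinates $i_k$ with $k\in S_j$ (in some order; if a coordinate is listed several times it is counted once in $S_j$). The rank of an Abelian group is the cardinality of a maximal $\mathbb{Z}$-linearly independent subset. *)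

(* Defs.v *)
From HB Require Import structures.
From mathcomp Require Import all_boot all_order all_algebra.
From mathcomp Require Import all_classical all_reals.

Set Implicit Arguments.
Unset Strict Implicit.
Unset Printing Implicit Defensive.

Import Order.TTheory GRing.Theory Num.Theory.

Local Open Scope classical_set_scope.
Local Open Scope ring_scope.

Definition is_subgroup (V : zmodType) (H : set V) : Prop := zmod_closed (mem H).

Definition subgroup_generated (V : zmodType) (A : set V) : set V :=
  smallest (@is_subgroup V) A.

Definition Zindependent (V : zmodType) (X : set V) : Prop :=
  forall (r : seq V) (c : V -> int),
    uniq r -> [set` r] `<=` X ->
    \sum_(v <- r) v *~ c v = 0 -> forall v, v \in r -> c v = 0.

Definition maximal_Zindependent (V : zmodType) (H X : set V) : Prop :=
  [/\ X `<=` H, Zindependent X &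
      forall Y : set V, X `<=` Y -> Y `<=` H -> Zindependent Y -> Y = X].

(* The value is 0 by convention when no maximal independent subset is finite;
   this cannot happen for a subgroup of Z^n. *)
Definition Zrank (V : zmodType) (H : set V) : nat :=
  xget 0%N [set n | exists2 X : set V, maximal_Zindependent H X & (X #= `I_n)%card].

(* Elements of Z^n are row vectors 'rV[int]_n. The index map sigma need be
   neither monotone nor injective: the selected coordinates may come in any
   order and with repetitions, and S is the set of those that occur. *)
Definition chooses_indices (d n : nat) (phi : 'rV[int]_d -> 'rV[int]_n)
    (S : {set 'I_d}) : Prop :=
  exists sigma : 'I_n -> 'I_d,
    S = [set sigma l | l : 'I_n]%SET /\
    forall x : 'rV[int]_d, phi x = \row_(l < n) x 0 (sigma l).

Definition coordinate_subgroup (d : nat) (i : 'I_d) : set 'rV[int]_d :=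
  subgroup_generated [set delta_mx 0 i].

(* Main.v *)
Require Import Defs.
From HB Require Import structures.
From mathcomp Require Import all_boot all_order all_algebra.
From mathcomp Require Import finmap.
From mathcomp Require Import all_classical all_reals.

Set Implicit Arguments.
Unset Strict Implicit.
Unset Printing Implicit Defensive.

Import Order.TTheory GRing.Theory Num.Theory.

Local Open Scope classical_set_scope.
Local Open Scope ring_scope.

(* Over the rationals the rank of H is the matrix rank of a basis A of H, so
   some rank(H) columns of A, indexed by a set I, are linearly independent.
   The columns of A indexed by the intersection of I and S_j remain
   independent in phi_j(H), hence rank(phi_j(H)) >= |I cap S_j|. On the
   coordinate subgroups the hypothesis says that the s_j with i in S_j sum to
   at least 1; summing this over i in I gives
   rank(H) = |I| <= sum_j s_j |I cap S_j| <= sum_j s_j rank(phi_j(H)). *)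

(** * Integer independence as linear independence over the rationals *)

Definition rat_row (n : nat) (v : 'rV[int]_n) : 'rV[rat]_n := map_mx intr v.

Definition rat_rows (n : nat) (r : seq 'rV[int]_n) : 'M[rat]_(size r, n) :=
  \matrix_(i < size r) rat_row r`_i.

Lemma rat_row_eq0 (n : nat) (v : 'rV[int]_n) : rat_row v = 0 -> v = 0.
Proof.
move=> /rowP v0; apply/rowP => i; apply/eqP.
by move: (v0 i); rewrite !mxE => /eqP; rewrite intr_eq0.
Qed.

Lemma rat_rows_comb (n : nat) (r : seq 'rV[int]_n) (c : 'rV[int]_n -> int) :
  (\row_(i < size r) (c r`_i)%:~R) *m rat_rows r =
  rat_row (\sum_(v <- r) v *~ c v).
Proof.
apply/rowP => j; rewrite !mxE summxE (big_nth 0) big_mkord rmorph_sum /=.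
by apply: eq_bigr => i _; rewrite !mxE -scaler_int mxE intz mulrC rmorphM mulrC.
Qed.

Lemma rV_rat_clear_denominators (k : nat) (v : 'rV[rat]_k) :
  exists2 a : int, a != 0 & exists w : 'rV[int]_k, a%:~R *: v = map_mx intr w.
Proof.
(* The row is read as a coefficient list, since [rat_poly_scale] clears the denominators of a
   polynomial. *)
have [q [a a0 vq]] := rat_poly_scale (rVpoly v).
exists a => //; exists (\row_i q`_i); apply/rowP => i.
rewrite !mxE -coef_rVpoly_ord vq coefZ coef_map /=.
by rewrite mulrA mulfV ?intr_eq0 // mul1r.
Qed.

(** Clearing denominators turns a rational relation into an integer one. [uniq r] appears because a
    set forgets repetitions, whereas a repeated row destroys freeness. *)
Lemma row_free_rat_rows (n : nat) (r : seq 'rV[int]_n) :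
  row_free (rat_rows r) <-> uniq r /\ Zindependent [set` r].
Proof.
split=> [Qfree | [r_uniq r_indep]].
  have r_uniq : uniq r.
    (* Equal entries at positions [i] and [j] give two unit vectors the same product with a free
       matrix. *)
    apply/(uniqP 0) => i j ir jr rij.
    have /(congr1 (fun u : 'rV_ _ => u 0 (Ordinal jr))) :
        delta_mx 0 (Ordinal ir) = delta_mx 0 (Ordinal jr) :> 'rV[rat]_(size r).
      by apply: (row_free_inj Qfree); rewrite -!rowE !rowK /= rij.
    rewrite !mxE !eqxx /= => /eqP; rewrite pnatr_eq1 eqb1.
    by move=> /eqP /(congr1 val).
  split=> // r' c r'_uniq r'r c0 v vr'.
  (* Extension by zero makes the relation on the sublist [r'] a relation on all of [r]. *)
  pose c' u := if u \in r' then c u else 0.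
  have vr : v \in r by exact: r'r.
  have c'0 : \sum_(u <- r) u *~ c' u = 0.
    have r'_perm : perm_eq r' [seq u <- r | u \in r'].
      apply: uniq_perm => //; first exact: filter_uniq.
      by move=> u; rewrite mem_filter; apply/esym/andb_idr => /r'r.
    apply: etrans _ c0; rewrite (perm_big _ r'_perm) /=.
    rewrite big_filter [RHS]big_mkcond /=; apply: eq_bigr => u _.
    by rewrite /c'; case: ifP => //; rewrite mulr0z.
  have := rat_rows_comb r c'; rewrite c'0 [rat_row _]map_mx0.
  move=> /eqP; rewrite mulmx_free_eq0 // => /eqP /rowP.
  have vi : (index v r < size r)%N by rewrite index_mem.
  move=> /(_ (Ordinal vi)); rewrite !mxE /= nth_index // /c' vr' => /eqP.
  by rewrite intr_eq0 => /eqP.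
apply: inj_row_free => v vQ0.
have [a a0 [w vw]] := rV_rat_clear_denominators v.
pose c x := \sum_(i < size r | r`_i == x) w 0 i.
have cE (i : 'I_(size r)) : c r`_i = w 0 i.
  rewrite /c (bigD1 i) //= big1 ?addr0 // => j /andP[/eqP rij /eqP[]].
  by apply/val_inj/eqP; rewrite -(nth_uniq 0 _ _ r_uniq) ?ltn_ord //; apply/eqP.
have sum0 : \sum_(u <- r) u *~ c u = 0.
  apply: rat_row_eq0; rewrite -rat_rows_comb.
  have -> : \row_(i < size r) (c r`_i)%:~R = a%:~R *: v :> 'rV[rat]_(size r).
    by rewrite vw; apply/rowP => i; rewrite !mxE cE.
  by rewrite -scalemxAl vQ0 scaler0.
have w0 : w = 0.
  apply/rowP => i; rewrite mxE -cE.
  by apply: (r_indep r c r_uniq _ sum0) => //; exact: mem_nth.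
move: vw => /eqP; rewrite w0 map_mx0 scaler_eq0 intr_eq0 (negPf a0) /=.
by move=> /eqP.
Qed.

Lemma rat_row_sub_rows (n : nat) (r : seq 'rV[int]_n) (v : 'rV[int]_n) :
  v \in r -> (rat_row v <= rat_rows r)%MS.
Proof.
move=> vr; have vi : (index v r < size r)%N by rewrite index_mem.
by apply: (eq_row_sub (Ordinal vi)); rewrite rowK /= nth_index.
Qed.

Lemma row_free_rat_rows_cons (n : nat) (r : seq 'rV[int]_n) (y : 'rV[int]_n) :
  row_free (rat_rows r) -> ~~ (rat_row y <= rat_rows r)%MS ->
  row_free (rat_rows (y :: r)).
Proof.
move=> Qfree yQ; rewrite -row_leq_rank /=.
have sQ : (rat_rows r <= rat_rows (y :: r))%MS.
  apply/row_subP => i; rewrite rowK; apply: rat_row_sub_rows.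
  by rewrite inE mem_nth ?orbT.
have : (rat_rows r < rat_rows (y :: r))%MS.
  rewrite ltmxE sQ /=; apply: contra yQ; apply: submx_trans.
  exact: (rat_row_sub_rows (mem_head y r)).
by move=> /rank_ltmx; rewrite (eqP Qfree).
Qed.

(** * [Zrank] as a rational matrix rank *)

Lemma maximal_Zindependent_exists (n : nat) (H : set 'rV[int]_n) :
  exists k : nat, exists2 X : set 'rV[int]_n,
    maximal_Zindependent H X & (X #= `I_k)%card.
Proof.
(* Free families in [H] have at most [n] members, so one of maximal size [k] exists; enlarging it
   would give size [k + 1]. *)
pose P k := `[< exists r : seq 'rV[int]_n,
  [/\ [set` r] `<=` H, row_free (rat_rows r) & size r = k] >].
have P0 : exists k, P k.
  exists 0%N; apply/asboolP; exists [::]; split => //.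
  by rewrite -row_leq_rank.
have Pn k : P k -> (k <= n)%N.
  by move=> /asboolP[r [_ /eqP + <-]] => <-; exact: rank_leq_col.
case: (ex_maxnP P0 Pn) => k /asboolP[r [rH Qfree rk]] kmax.
have [r_uniq r_indep] := (row_free_rat_rows r).1 Qfree.
exists k, [set` r]; last first.
  have -> : [set` r] = [set` [fset x in r]%fset].
    by apply/seteqP; split=> x /=; rewrite inE.
  by apply/card_eq_fsetP; rewrite card_fseq undup_id.
split=> // Y rY YH Y_indep; apply/seteqP; split=> // y Yy.
apply: contrapT => /negP /= yr.
have : (k < k)%N; last by rewrite ltnn.
apply: kmax; apply/asboolP; exists (y :: r); split; last by rewrite /= rk.
  by move=> x /=; rewrite inE => /predU1P[->|/rH]; [exact: YH|].
apply/row_free_rat_rows; split; first by rewrite /= yr.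
move=> s c s_uniq sr; apply: Y_indep => // x /sr /=.
by rewrite inE => /predU1P[->|/rY].
Qed.

(** The list enumerates the maximal independent set behind [Zrank H]. It spans [H] rationally: a [y]
    outside the span could be adjoined, against maximality. *)
Lemma Zrank_basis (n : nat) (H : set 'rV[int]_n) :
  exists r : seq 'rV[int]_n,
    [/\ [set` r] `<=` H, row_free (rat_rows r), size r = Zrank H &
        forall y, H y -> (rat_row y <= rat_rows r)%MS].
Proof.
have [X [XH X_indep X_max] XI] :=
  xgetPex 0%N (maximal_Zindependent_exists H).
have /finite_fsetP[F XF] : finite_set X by exists (Zrank H).
move: XH X_indep X_max XI; rewrite {}XF => FH F_indep F_max FI.
have Qfree : row_free (rat_rows F).
  by apply/row_free_rat_rows; split=> //; exact: fset_uniq.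
exists F; split=> //; first exact/card_eq_fsetP.
move=> y Hy; apply: contrapT => /negP yQ.
have [_ yF_indep] :=
  (row_free_rat_rows (y :: F)).1 (row_free_rat_rows_cons Qfree yQ).
have yF : [set` y :: F] = [set` F].
  apply: F_max => // x /=; rewrite inE; first by move=> ->; rewrite orbT.
  by move=> /predU1P[->|/FH].
have : [set` y :: F] y by rewrite /= mem_head.
by rewrite yF => /rat_row_sub_rows; apply/negP.
Qed.

Lemma rank_leq_Zrank (n k : nat) (H : set 'rV[int]_n) (A : 'M[int]_(k, n)) :
  (forall i, H (row i A)) ->
  (\rank (map_mx intr A : 'M[rat]_(k, n)) <= Zrank H)%N.
Proof.
move=> AH; have [r [_ /eqP Qrank <- r_span]] := Zrank_basis H.
rewrite -Qrank; apply/mxrankS/row_subP => i.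
by rewrite -map_row; exact: r_span.
Qed.

Lemma Zrank_matrix (n : nat) (H : set 'rV[int]_n) :
  exists A : 'M[int]_(Zrank H, n),
    (forall i, H (row i A)) /\ row_free (map_mx intr A : 'M[rat]_(Zrank H, n)).
Proof.
have [r [rH Qfree <- _]] := Zrank_basis H.
exists (\matrix_(i < size r) r`_i); split.
  by move=> i; rewrite rowK; apply: rH; exact: mem_nth.
rewrite (_ : map_mx _ _ = rat_rows r) //.
by apply/row_matrixP => i; rewrite -map_row !rowK.
Qed.

Lemma Zrank_multiples (n : nat) (H : set 'rV[int]_n) (v : 'rV[int]_n) :
  (forall x, H x -> exists a : int, x = v *~ a) -> (Zrank H <= (v != 0%R))%N.
Proof.
move=> Hv; have [A [AH /eqP <-]] := Zrank_matrix H.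
have -> : (v != 0) = \rank (rat_row v) :> nat.
  rewrite rank_rV; congr (nat_of_bool (~~ _)); apply/eqP/eqP => [->|].
    by rewrite [rat_row _]map_mx0.
  exact: rat_row_eq0.
apply/mxrankS/row_subP => i; rewrite -map_row.
have [a ->] := Hv _ (AH i).
rewrite raddfMz /= -scaler_int; exact: scalemx_sub.
Qed.

(** * Coordinate subgroups and their images *)

Lemma subgroup_generated_closed (V : zmodType) (A : set V) :
  is_subgroup (subgroup_generated A).
Proof.
split; first by rewrite inE => B [/= [+ _] _]; rewrite inE.
move=> x y /set_mem xA /set_mem yA; rewrite inE => B BA.
have [/= [_ Bsub] _] := BA.
by apply/set_mem/Bsub; rewrite inE; [exact: xA | exact: yA].
Qed.

Lemma coordinate_subgroup_delta (d : nat) (i : 'I_d) :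
  coordinate_subgroup i (delta_mx 0 i).
Proof. by move=> B [_]; apply. Qed.

Lemma coordinate_subgroup_multiple (d : nat) (i : 'I_d) (x : 'rV[int]_d) :
  coordinate_subgroup i x -> exists a : int, x = delta_mx 0 i *~ a.
Proof.
pose M : set 'rV[int]_d := [set y | exists a : int, y = delta_mx 0 i *~ a].
apply: (_ : coordinate_subgroup i `<=` M); apply: bigcap_inf.
split; last by move=> _ ->; exists 1; rewrite mulr1z.
split; first by rewrite inE; exists 0; rewrite mulr0z.
move=> _ _ /set_mem[a ->] /set_mem[b ->]; rewrite inE.
by exists (a - b); rewrite mulrzBr.
Qed.

Lemma Zrank_coordinate_subgroup_ge1 (d : nat) (i : 'I_d) :
  (1 <= Zrank (coordinate_subgroup i))%N.
Proof.
have := @rank_leq_Zrank _ 1 (coordinate_subgroup i) (delta_mx 0 i).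
rewrite map_delta_mx mxrank_delta; apply => l.
by rewrite ord1 row_id; exact: coordinate_subgroup_delta.
Qed.

Lemma Zrank_image_coordinate_subgroup (d n : nat)
    (phi : {additive 'rV[int]_d -> 'rV[int]_n}) (S : {set 'I_d})
    (phiS : chooses_indices phi S) (i : 'I_d) :
  (Zrank (phi @` coordinate_subgroup i) <= (i \in S))%N.
Proof.
have [sigma [SE phiE]] := phiS.
apply: leq_trans (Zrank_multiples (v := phi (delta_mx 0 i)) _) _.
  move=> _ [x /coordinate_subgroup_multiple[a ->] <-].
  by exists a; rewrite raddfMz.
case: (boolP (i \in S)) => [_|iS]; first exact: leq_b1.
(* If [i] is not chosen, every selected coordinate of the basis vector vanishes. *)
suff -> : phi (delta_mx 0 i) = 0 by rewrite eqxx.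
apply/rowP => l; rewrite phiE !mxE eqxx /=.
case: eqP => // il; move: iS; rewrite SE => /negP[].
by apply/imsetP; exists l.
Qed.

(** The columns of [A] picked by [f] form an invertible square matrix, so those with index in [S]
    are independent, and each of them is also a column of the matrix of images under [phi]. *)
Lemma rank_chosen_columns (d n : nat)
    (phi : {additive 'rV[int]_d -> 'rV[int]_n}) (S : {set 'I_d})
    (phiS : chooses_indices phi S) (k : nat) (H : set 'rV[int]_d)
    (A : 'M[int]_(k, d)) (f : 'I_k -> 'I_d) :
  (forall i, H (row i A)) ->
  rowsub f (map_mx intr A : 'M[rat]_(k, d))^T \in unitmx ->
  (#|[set l | f l \in S]%SET| <= Zrank (phi @` H))%N.
Proof.
move=> AH fA; have [sigma [SE phiE]] := phiS.
set AQ := map_mx intr A : 'M[rat]_(k, d); set T := [set l | _]%SET.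
(* [g] picks one output position of [phi] for each index counted in [T], which handles the order and
   repetitions of [sigma]. *)
have /fin_all_exists[g gE] (t : 'I_#|T|) :
    exists l : 'I_n, f (enum_val t) = sigma l.
  by have := enum_valP t; rewrite inE SE => /imsetP[l _ ->]; exists l.
have : (\rank (map_mx intr (colsub sigma A) : 'M[rat]_(k, n)) <=
        Zrank (phi @` H))%N.
  apply: rank_leq_Zrank => i; exists (row i A); first exact: AH.
  by rewrite phiE; apply/rowP => l; rewrite !mxE.
apply: leq_trans.
rewrite map_mxsub -mxrank_tr -/AQ.
have -> : (colsub sigma AQ)^T = rowsub sigma AQ^T.
  by apply/matrixP => x y; rewrite !mxE.
apply: leq_trans (mxrankS (rowsub_comp_sub sigma g AQ^T)).
rewrite -(@eq_rowsub _ _ _ _ (f \o enum_val)) //.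
rewrite rowsub_comp rowsubE mxrankMfree ?row_free_unit //.
(* With the invertible factor removed, distinct rows of the identity remain; their transpose is a
   right inverse. *)
rewrite row_leq_rank; apply/row_freeP; exists (rowsub enum_val 1%:M)^T.
apply/matrixP => t t'; rewrite !mxE (bigD1 (enum_val t)) //= !mxE eqxx mul1r.
rewrite big1 ?addr0 => [|l lt].
  by rewrite (inj_eq enum_val_inj) eq_sym.
by rewrite !mxE eq_sym (negPf lt) mul0r.
Qed.

Theorem theorem6p6 (R : realType) (d m : nat) (dims : 'I_m -> nat)
    (phi : forall j : 'I_m, {additive 'rV[int]_d -> 'rV[int]_(dims j)})
    (S : 'I_m -> {set 'I_d})
    (phiS : forall j : 'I_m, chooses_indices (phi j) (S j))
    (s : 'I_m -> R) (s01 : forall j : 'I_m, 0 <= s j <= 1) :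
  (forall i : 'I_d,
     (Zrank (coordinate_subgroup i))%:R
       <= \sum_(j < m) s j * (Zrank (phi j @` coordinate_subgroup i))%:R)
  <->
  (forall H : set 'rV[int]_d, is_subgroup H ->
     (Zrank H)%:R <= \sum_(j < m) s j * (Zrank (phi j @` H))%:R).
Proof.
split=> [rankH_i H _|rankH i]; last exact/rankH/subgroup_generated_closed.
have s_ge0 j : 0 <= s j by have /andP[] := s01 j.
have cover i : 1 <= \sum_(j < m) s j * (i \in S j)%:R.
  apply: le_trans (_ : (Zrank (coordinate_subgroup i))%:R <= _).
    by rewrite ler1n Zrank_coordinate_subgroup_ge1.
  apply: le_trans (rankH_i i) _; apply: ler_sum => j _.
  by rewrite ler_wpM2l // ler_nat Zrank_image_coordinate_subgroup.
have [A [AH Afree]] := Zrank_matrix H.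
have Afull : row_full (map_mx intr A : 'M[rat]_(_, d))^T.
  by rewrite /row_full mxrank_tr.
(* [f] enumerates the set I of independent columns: it selects [Zrank H] rows of the transpose that
   form an invertible matrix. *)
pose f := fullrankfun Afull.
have fA := fullrowsub_unit Afull.
apply: le_trans (_ : \sum_(l < Zrank H) \sum_(j < m) s j * (f l \in S j)%:R <= _).
  rewrite -[leLHS](_ : \sum_(l < Zrank H) 1 = _); last first.
    by rewrite sumr_const card_ord.
  by apply: ler_sum => l _; exact: cover.
(* For fixed [j], the inner sum now counts the selected columns whose index lies in [S j]. *)
rewrite exchange_big /=; apply: ler_sum => j _; rewrite -mulr_sumr.
rewrite ler_wpM2l //.
have -> : \sum_(l < Zrank H) (f l \in S j)%:R = #|[set l | f l \in S j]%SET|%:R :> R.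
  rewrite -natr_sum -big_mkcond sum1_card; congr _%:R.
  by apply: eq_card => l; rewrite inE.
by rewrite ler_nat; exact: (rank_chosen_columns (phiS j) AH fA).
Qed.
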